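(* Let $n\ge 1$ be an integer and write $n=6p+d$ with integers $p\ge 0$ and $0\le d\le 5$. Let $k$ be a field, $S=k[x_1,\ldots,x_n]$, and let $NI(P_n^2)\subseteq S$ be the closed neighborhood ideal of the square of the path graph $P_n$. Then the Castelnuovo--Mumford regularity of $S/NI(P_n^2)$ is $$\operatorname{reg}\left(\frac{S}{NI(P_n^2)}\right)=\begin{cases}4p,& d\in\{0,1\}\\ 4p+1,& d=2\\ 4p+2,& d\in\{3,4\}\\ 4p+3,& d=5\end{cases}$$ and the projective dimension of $S/NI(P_n^2)$ over $S$ is $$\operatorname{pd}\left(\frac{S}{NI(P_n^2)}\right)=\begin{cases}2p,& d=0\\ 2p+1,& d\in\{1,2,3\}\\ 2p+2,& d\in\{4,5\}.\end{cases}$$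
   Context: The path graph $P_n$ has vertex set $\{x_1,\ldots,x_n\}$ and edges $\{x_i,x_{i+1}\}$ for $1\le i\le n-1$. Its square $P_n^2$ has the same vertex set and edge set $\{\{x_i,x_{i+1}\}:1\le i\le n-1\}\cup\{\{x_i,x_{i+2}\}:1\le i\le n-2\}$. For a finite simple graph $G$ and a vertex $x$, $N(x)$ is the set of vertices adjacent to $x$, and $N[x]=N(x)\cup\{x\}$ is the closed neighborhood of $x$. For a finite simple graph $G$ with vertices $x_1,\ldots,x_n$ (identified with the variables of $S=k[x_1,\ldots,x_n]$), the closed neighborhood ideal is the squarefree monomial ideal $NI(G)=\left(\prod_{x_j\in N[x_i]}x_j : 1\le i\le n\right)\subseteq S$. The ring $S$ carries the standard grading. *)

(* Defs.v *)
From HB Require Import structures.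
From mathcomp Require Import all_boot all_order all_algebra.
From mathcomp Require Import generic_quotient ring_quotient boolp mpoly.

Set Implicit Arguments.
Unset Strict Implicit.
Unset Printing Implicit Defensive.

Import Order.TTheory GRing.Theory Num.Theory.
Local Open Scope ring_scope.
Local Open Scope quotient_scope.

Section CyclicModule.
Variables (R : comNzRingType) (t : nat) (g : 'I_t -> R).

Definition ideal_gen : {pred R} :=
  fun f => `[< exists c : 'I_t -> R, f = \sum_i c i * g i >].

Lemma ideal_genP f :
  reflect (exists c : 'I_t -> R, f = \sum_i c i * g i) (f \in ideal_gen).
Proof. exact: asboolP. Qed.

Fact ideal_gen_zmod_closed : zmod_closed ideal_gen.
Proof.
split=> [|f h /ideal_genP[c ->] /ideal_genP[e ->]]; apply/ideal_genP.
  by exists (fun=> 0); rewrite big1 // => i _; rewrite mul0r.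
exists (fun i => c i - e i); rewrite -sumrB.
by apply: eq_bigr => i _; rewrite mulrBl.
Qed.

HB.instance Definition _ :=
  GRing.isZmodClosed.Build R ideal_gen ideal_gen_zmod_closed.

Lemma ideal_genM a f : f \in ideal_gen -> a * f \in ideal_gen.
Proof.
move=> /ideal_genP[c ->]; apply/ideal_genP; exists (fun i => a * c i).
by rewrite mulr_sumr; apply: eq_bigr => i _; rewrite mulrA.
Qed.

(* R/(g), as an R-module rather than as a ring: the generic ideal quotient of
   the library requires a proper ideal and carries no R-module structure. *)
Definition cyclic_mod := Quotient.quot ideal_gen.

HB.instance Definition _ := GRing.Zmodule.on cyclic_mod.

Definition cyclic_pi (f : R^o) : cyclic_mod := \pi_(Quotient.quot ideal_gen) f.

Lemma cyclic_pi_surj x : exists f, cyclic_pi f = x.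
Proof. by exists (repr x); apply: reprK. Qed.

Lemma cyclic_pi_eq f h : cyclic_pi f = cyclic_pi h <-> f - h \in ideal_gen.
Proof. by rewrite Quotient.idealrBE; split=> [/eqP|/eqP]. Qed.

Fact cyclic_pi_additive : zmod_morphism cyclic_pi.
Proof. by move=> f h; rewrite /cyclic_pi raddfB. Qed.

Definition cyclic_scale (a : R) (x : cyclic_mod) : cyclic_mod :=
  cyclic_pi (a * repr x).

Lemma cyclic_scale_pi a f : cyclic_scale a (cyclic_pi f) = cyclic_pi (a * f).
Proof.
apply/cyclic_pi_eq; rewrite -mulrBr; apply: ideal_genM.
by apply/cyclic_pi_eq; apply: reprK.
Qed.

Let cyclic_piD f h : cyclic_pi f + cyclic_pi h = cyclic_pi (f + h).
Proof. by rewrite /cyclic_pi raddfD. Qed.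

Fact cyclic_scaleA a b x :
  cyclic_scale a (cyclic_scale b x) = cyclic_scale (a * b) x.
Proof. by have [f <-] := cyclic_pi_surj x; rewrite !cyclic_scale_pi mulrA. Qed.

Fact cyclic_scale1 : left_id 1 cyclic_scale.
Proof. by move=> x; have [f <-] := cyclic_pi_surj x; rewrite cyclic_scale_pi mul1r. Qed.

Fact cyclic_scaleDr : right_distributive cyclic_scale +%R.
Proof.
move=> a x y; have [f <-] := cyclic_pi_surj x; have [h <-] := cyclic_pi_surj y.
by rewrite cyclic_piD !cyclic_scale_pi cyclic_piD mulrDr.
Qed.

Fact cyclic_scaleDl x : {morph cyclic_scale^~ x : a b / a + b}.
Proof.
move=> a b; have [f <-] := cyclic_pi_surj x.
by rewrite !cyclic_scale_pi cyclic_piD mulrDl.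
Qed.

HB.instance Definition _ := GRing.Zmodule_isLmodule.Build R cyclic_mod
  cyclic_scaleA cyclic_scale1 cyclic_scaleDr cyclic_scaleDl.

HB.instance Definition _ :=
  GRing.isZmodMorphism.Build R^o cyclic_mod cyclic_pi cyclic_pi_additive.

Fact cyclic_pi_scalable : scalable cyclic_pi.
Proof. by move=> a f; apply: esym; apply: cyclic_scale_pi. Qed.

HB.instance Definition _ :=
  GRing.isScalable.Build R R^o cyclic_mod *:%R cyclic_pi cyclic_pi_scalable.

End CyclicModule.

Definition surj_fun (A B : Type) (f : A -> B) : Prop := forall y, exists x, f x = y.

Definition exact_at (A B : Type) (C : zmodType) (f : A -> B) (g : B -> C) : Prop :=
  forall y, g y = 0 <-> exists x, f x = y.

Section ProjectiveDimension.
Variable R : pzRingType.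

Definition projective (P : lmodType R) : Prop :=
  forall (A B : lmodType R) (q : {linear A -> B}) (f : {linear P -> B}),
    surj_fun q -> exists h : {linear P -> A}, forall x, q (h x) = f x.

Record proj_resolution (M : lmodType R) := ProjResolution {
  pres_mod : nat -> lmodType R;
  pres_diff : forall i, {linear pres_mod i.+1 -> pres_mod i};
  pres_aug : {linear pres_mod 0%N -> M};
  pres_proj : forall i, projective (pres_mod i);
  pres_aug_surj : surj_fun pres_aug;
  pres_exact0 : exact_at (pres_diff 0) pres_aug;
  pres_exact : forall i, exact_at (pres_diff i.+1) (pres_diff i) }.

Definition pres_length_le (M : lmodType R) (P : proj_resolution M) (l : nat) : Prop :=
  forall i, (l < i)%N -> forall x : pres_mod P i, x = 0.

Definition has_projdim (M : lmodType R) (l : nat) : Prop :=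
  (exists P : proj_resolution M, pres_length_le P l) /\
  (forall (P : proj_resolution M) l', pres_length_le P l' -> (l <= l')%N).

End ProjectiveDimension.

Section Regularity.
Variables (n : nat) (k : fieldType).
Local Notation S := {mpoly k[n]}.

(* The zero polynomial is homogeneous of every degree, and it is the only
   polynomial homogeneous of a negative degree. *)
Definition homog_of_deg (j : int) (f : S) : Prop :=
  forall m, m \in msupp f -> (mdeg m)%:Z = j.

Definition rv_mul (a b : nat) (D : 'M[S]_(a, b)) (v : 'rV[S]_a) : 'rV[S]_b :=
  v *m D.

(* A module M graded by its homogeneous components [Mdeg j].  The i-th free
   module is the sum of the S(- gres_shift i r) for r < gres_rank i, written as
   row vectors, with differentials acting by right multiplication. *)
Record min_graded_free_resolution
    (M : lmodType S) (Mdeg : int -> M -> Prop) := MinGradedFreeResolution {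
  gres_rank : nat -> nat;
  gres_shift : forall i, 'I_(gres_rank i) -> int;
  gres_diff : forall i, 'M[S]_(gres_rank i.+1, gres_rank i);
  gres_aug : {linear 'rV[S]_(gres_rank 0%N) -> M};
  gres_aug_surj : surj_fun gres_aug;
  gres_exact0 : exact_at (rv_mul (gres_diff 0)) gres_aug;
  gres_exact : forall i,
    exact_at (rv_mul (gres_diff i.+1)) (rv_mul (gres_diff i));
  gres_aug_homog : forall r,
    Mdeg (gres_shift r) (gres_aug (delta_mx 0 r));
  gres_diff_homog : forall i r c,
    homog_of_deg (gres_shift r - gres_shift c) (gres_diff i r c);
  (* entries in (x_1, ..., x_n) *)
  gres_minimal : forall i r c, (gres_diff i r c)@_0%MM = 0 }.

Definition betti (M : lmodType S) (Mdeg : int -> M -> Prop)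
    (F : min_graded_free_resolution Mdeg) (i : nat) (j : int) : nat :=
  #|[set r : 'I_(gres_rank F i) | gres_shift r == j]|.

Definition is_max (A : int -> Prop) (x : int) : Prop :=
  A x /\ forall y, A y -> y <= x.

(* max {j - i : beta_{i,j}(M) != 0}; the second clause makes the value
   independent of the minimal resolution computing the Betti numbers. *)
Definition has_regularity (M : lmodType S) (Mdeg : int -> M -> Prop) (x : int) : Prop :=
  inhabited (min_graded_free_resolution Mdeg) /\
  forall F : min_graded_free_resolution Mdeg,
    is_max (fun y => exists i j, betti F i j <> 0%N /\ y = j - i%:Z) x.

Definition cyclic_deg (t : nat) (g : 'I_t -> S) (j : int) (x : cyclic_mod g) : Prop :=
  exists2 f : S, homog_of_deg j f & x = cyclic_pi g f.

End Regularity.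

Definition closed_nbhd (V : finType) (e : rel V) (x : V) : {set V} :=
  [set y | (y == x) || e x y].

Definition NI_gen (n : nat) (k : fieldType) (e : rel 'I_n) (i : 'I_n) : {mpoly k[n]} :=
  \prod_(j in closed_nbhd e i) 'X_j.

(* S / NI(G) for the graph G on 'I_n with adjacency relation e *)
Definition NI_quot (n : nat) (k : fieldType) (e : rel 'I_n) : lmodType {mpoly k[n]} :=
  cyclic_mod (NI_gen k e).

Definition NI_deg (n : nat) (k : fieldType) (e : rel 'I_n) :
    int -> NI_quot k e -> Prop :=
  @cyclic_deg n k n (NI_gen k e).

Definition path_sq (n : nat) : rel 'I_n := fun i j =>
  [|| j == i.+1 :> nat, i == j.+1 :> nat, j == i.+2 :> nat | i == j.+2 :> nat].

(* Main.v *)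
(* Number the variables from 0. Let J_m be the ideal generated by x_0 x_1 x_2
   (if m >= 3) and the products x_i ... x_(i+4) with 1 <= i and i + 5 <= m, and
   let N_m be the closed neighborhood ideal of P_m^2. With the products
   v = x_(q+1) ... x_(q+5) and w = x_q x_(q+1) x_(q+2),
     J_(q+6) = J_(q+5) + (v),   J_(q+5) : v = J_q + (x_q),
     N_(q+3) = J_(q+2) + (w),   J_(q+2) : w = N_q.
   The last variable x of the new generator u = x u' occurs in none of the
   generators of the old ideal I, so that I : u = I : u', and multiplication by
   u from S/(I : u) to S/I lifts to x times a lift of multiplication by u'. The
   mapping cone of that lift is therefore a minimal resolution of S/(I + (u)),
   and reg and pd obey max-recursions, whose solutions are 2 floor(m/3) and
   floor(m/3) for J_m, floor(2m/3) and ceil(m/3) for N_m.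

   Any other resolution is compared with this one by lifting the identity both
   ways: the composite is the identity up to homotopy, hence modulo the
   homogeneous maximal ideal. *)

Require Import Defs.
From mathcomp Require Import all_boot all_order all_algebra.
From HB Require Import structures.
From mathcomp Require Import boolp mpoly zify ring.

Set Implicit Arguments.
Unset Strict Implicit.
Unset Printing Implicit Defensive.

Import Order.TTheory GRing.Theory Num.Theory.
Local Open Scope ring_scope.

(** * Comparison of resolutions *)

Section ImageSubmodule.
Variables (R : pzRingType) (A B : lmodType R) (q : {linear A -> B}).

Definition im_pred : {pred B} := fun y => `[< exists x, q x = y >].

Lemma im_predP y : reflect (exists x, q x = y) (y \in im_pred).
Proof. exact: asboolP. Qed.

Fact im_submod_closed : submod_closed im_pred.
Proof.
split=> [|a _ _ /im_predP[x <-] /im_predP[y <-]]; apply/im_predP.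
  by exists 0; rewrite linear0.
by exists (a *: x + y); rewrite linearP.
Qed.

HB.instance Definition _ :=
  GRing.isSubmodClosed.Build R B im_pred im_submod_closed.

(** [projective] lifts only through surjections, so the image of [q] is made into a module of its
    own, onto which [q] corestricts surjectively. *)
Record im_mod := ImMod { im_val : B; im_valP : im_val \in im_pred }.

HB.instance Definition _ := [isSub for im_val].
HB.instance Definition _ := [Choice of im_mod by <:].
HB.instance Definition _ := [SubChoice_isSubLmodule of im_mod by <:].

Lemma projective_lift (P : lmodType R) (f : {linear P -> B}) :
    projective P -> (forall x, exists y, q y = f x) ->
  exists h : {linear P -> A}, forall x, q (h x) = f x.
Proof.
move=> projP fq.
have qim x : q x \in im_pred by apply/im_predP; exists x.
have fim x : f x \in im_pred by apply/im_predP.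
pose q1 x := ImMod (qim x); pose f1 x := ImMod (fim x).
have q1lin : linear q1 by move=> a x y; apply: val_inj; rewrite /= linearP.
have f1lin : linear f1 by move=> a x y; apply: val_inj; rewrite /= linearP.
pose q2 : {linear A -> im_mod} :=
  HB.pack q1 (GRing.isLinear.Build _ _ _ _ q1 q1lin).
pose f2 : {linear P -> im_mod} :=
  HB.pack f1 (GRing.isLinear.Build _ _ _ _ f1 f1lin).
have q2surj : surj_fun q2.
  by move=> [y yim]; case/im_predP: (yim) => x qx; exists x; apply: val_inj.
have [h hE] := projP _ _ q2 f2 q2surj.
by exists h => x; have /(congr1 val) := hE x.
Qed.

End ImageSubmodule.

(* ZP and ZQ are the cycles. The predicate ok is any condition that survives
   lifting: homogeneity for graded resolutions, nothing for arbitrary projective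
   ones. The members of small stand for the vectors with entries in the maximal
   ideal. *)
Section Comparison.
Variables (R : pzRingType) (P Q : nat -> lmodType R).
Variables (dP : forall i, {linear P i.+1 -> P i}).
Variables (dQ : forall i, {linear Q i.+1 -> Q i}).
Variables (ZP : forall i, P i -> Prop) (ZQ : forall i, Q i -> Prop).
Variable ok : forall i, {linear P i -> Q i} -> Prop.
Variable small : forall i, P i -> Prop.

Hypothesis ZP_bound : forall i x, ZP (dP i x).
Hypothesis ZPS : forall i (x : P i.+1), ZP x <-> dP i x = 0.
Hypothesis ZQS : forall i (x : Q i.+1), ZQ x <-> dQ i x = 0.
Hypothesis liftPQ : forall i (f : {linear P i -> Q i}),
  ok f -> (forall x, ZP x -> ZQ (f x)) ->
  exists2 f' : {linear P i.+1 -> Q i.+1}, ok f' &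
    forall x, dQ i (f' x) = f (dP i x).
Hypothesis liftQP : forall i (g : {linear Q i -> P i}),
  (forall x, ZQ x -> ZP (g x)) ->
  exists g' : {linear Q i.+1 -> P i.+1}, forall x, dP i (g' x) = g (dQ i x).
Hypothesis liftPP : forall i (e : {linear P i -> P i}),
  (forall x, ZP (e x)) ->
  exists h : {linear P i -> P i.+1}, forall x, dP i (h x) = e x.
Hypothesis smallD : forall i (x y : P i), small x -> small y -> small (x + y).
Hypothesis small_d : forall i x, small (dP i x).
Hypothesis small_lin : forall i (h : {linear P i -> P i.+1}) x,
  small x -> small (h x).

(** The induction keeps the homotopy equation on cycles only. There the term coming from the
    previous degree vanishes, so a single map [h] suffices to pass to the next degree. *)
Lemma comparison (f0 : {linear P 0 -> Q 0}) (g0 : {linear Q 0 -> P 0}) :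
    ok f0 -> (forall x, ZP x -> ZQ (f0 x)) -> (forall x, ZQ x -> ZP (g0 x)) ->
    (forall x, ZP (g0 (f0 x) - x)) ->
  forall i, exists2 f : {linear P i -> Q i}, ok f &
    exists g : {linear Q i -> P i}, forall x, small (g (f x) - x).
Proof.
move=> ok0 f0Z g0Z gf0 i.
suff [f [okf _] [g [_ _ gf]]] : exists2 f : {linear P i -> Q i},
    ok f /\ (forall x, ZP x -> ZQ (f x)) &
    exists g : {linear Q i -> P i}, [/\ forall x, ZQ x -> ZP (g x),
      exists h : {linear P i -> P i.+1},
        forall x, ZP x -> dP i (h x) = g (f x) - x
      & forall x, small (g (f x) - x)].
  by exists f => //; exists g.
elim: i => [|i [f [okf fZ] [g [gZ [h hE] _]]]].
  exists f0 => //; exists g0.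
  pose e : {linear P 0 -> P 0} := (g0 \o f0) \- idfun.
  have [h hE] := liftPP (e := e) gf0.
  have gf x : g0 (f0 x) - x = dP 0 (h x) by rewrite hE.
  split=> // [|x]; last by rewrite gf; apply: small_d.
  by exists h => x _; rewrite gf.
have [f' okf' f'E] := liftPQ okf fZ; have [g' g'E] := liftQP gZ.
have f'Z x : ZP x -> ZQ (f' x).
  by move/ZPS => dx; apply/ZQS; rewrite f'E dx linear0.
have g'Z x : ZQ x -> ZP (g' x).
  by move/ZQS => dx; apply/ZPS; rewrite g'E dx linear0.
(* Subtracting [h \o dP i] makes [e] land in the cycles: [dP i x] is a cycle, so [hE] applies to it.
   Lifting [e] gives the next homotopy [h']. *)
pose e : {linear P i.+1 -> P i.+1} := ((g' \o f') \- idfun) \- (h \o dP i).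
have eZ x : ZP (e x).
  by apply/ZPS; rewrite /e /= !linearB /= g'E f'E hE ?subrr.
have [h' h'E] := liftPP eZ.
exists f' => //; exists g'; split=> // [|x].
  by exists h' => x /ZPS dx; rewrite h'E /e /= dx linear0 subr0.
have -> : g' (f' x) - x = dP i.+1 (h' x) + h (dP i x).
  by rewrite h'E /e /= subrK.
by apply: smallD => //; apply: small_lin; apply: small_d.
Qed.

End Comparison.

(** * Homogeneous components and monomial ideals *)

Section MonomialIdeals.
Variables (n : nat) (k : fieldType).
Local Notation S := {mpoly k[n]}.

(** Degrees are integers because they arise as differences of shifts, which may be negative; the
    component is then 0. *)
Definition hcomp (j : int) (f : S) : S :=
  if j is Posz d then pihomog mdeg d f else 0.

Lemma hcompE j m : hcomp j 'X_[m] = if (mdeg m)%:Z == j then 'X_[m] else 0.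
Proof. by case: j => d //=; rewrite pihomogX. Qed.

Fact hcomp_linear j : linear (hcomp j).
Proof. by case: j => d a f h /=; [rewrite linearP | rewrite scaler0 addr0]. Qed.

HB.instance Definition _ j :=
  GRing.isLinear.Build k S S *:%R (hcomp j) (hcomp_linear j).

Lemma mcoeff_hcomp j f m :
  (hcomp j f)@_m = if (mdeg m)%:Z == j then f@_m else 0.
Proof.
rewrite [in LHS](mpolyE f) linear_sum raddf_sum /=.
transitivity ((\sum_(m' <- msupp f)
    f@_m' * (if (mdeg m)%:Z == j then (m' == m)%:R else 0)) : k).
  apply: eq_bigr => m' _; rewrite linearZ /= mcoeffZ hcompE.
  have [->|ne] := eqVneq m' m.
    by case: ifP; rewrite ?mcoeffX ?eqxx ?mcoeff0.
  by case: ifP => _; rewrite ?mcoeffX ?mcoeff0 ?(negPf ne); case: ifP.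
case: ifP => _; last by rewrite big1 // => m' _; rewrite mulr0.
rewrite [in RHS](mpolyE f) raddf_sum /=.
by apply: eq_bigr => m' _; rewrite mcoeffZ mcoeffX.
Qed.

Lemma homog_coeffP j (f : S) :
  homog_of_deg j f <-> (forall m, f@_m != 0 -> (mdeg m)%:Z = j).
Proof. by split=> h m; have := h m; rewrite mcoeff_msupp. Qed.

Lemma hcomp_homog j f : homog_of_deg j (hcomp j f).
Proof.
apply/homog_coeffP => m; rewrite mcoeff_hcomp.
by case: ifP => [/eqP //|_]; rewrite eqxx.
Qed.

Lemma hcomp_id j f : homog_of_deg j f -> hcomp j f = f.
Proof.
move=> /homog_coeffP hf; apply/mpolyP => m; rewrite mcoeff_hcomp.
case: ifP => // /eqP ne.
by apply/esym/eqP; apply: contraT => /hf.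
Qed.

Lemma hcompM j l (f g : S) :
  homog_of_deg l g -> hcomp (j + l) (f * g) = hcomp j f * g.
Proof.
move=> hg; rewrite (mpolyE f) mulr_suml !linear_sum /= mulr_suml.
apply: eq_bigr => m _; rewrite {1}[g]mpolyE mulr_sumr linear_sum /=.
rewrite [in RHS](mpolyE g) mulr_sumr; apply: eq_big_seq => m' /hg m'l.
rewrite -scalerAl -scalerAr !linearZ /= -scalerAl -scalerAr.
congr (_ *: (_ *: _)).
rewrite -mpolyXD !hcompE mdegD PoszD m'l (inj_eq (addIr l)).
by case: ifP; rewrite ?mul0r // mpolyXD.
Qed.

Lemma homogX m : homog_of_deg (mdeg m)%:Z ('X_[m] : S).
Proof. by move=> m'; rewrite msuppX inE => /eqP ->. Qed.

Lemma homog1 : homog_of_deg 0 (1 : S).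
Proof. by have := @homogX 0%MM; rewrite mdeg0 mpolyX0. Qed.

Lemma homog0 j : homog_of_deg j (0 : S).
Proof. by move=> m; rewrite msupp0. Qed.

Lemma homogN j (f : S) : homog_of_deg j f -> homog_of_deg j (- f).
Proof. by move=> hf m; rewrite (perm_mem (msuppN f)); apply: hf. Qed.

Lemma homogM j l (f g : S) :
  homog_of_deg j f -> homog_of_deg l g -> homog_of_deg (j + l) (f * g).
Proof.
move=> hf hg; rewrite -(hcomp_id hf) -(hcompM _ _ hg); exact: hcomp_homog.
Qed.

Section MonoIdeal.
Variable U : 'X_{1..n} -> Prop.

(* When U is closed under multiples, this is the ideal spanned by the monomials
   in U. *)
Definition mono_ideal (f : S) : Prop := forall m, m \in msupp f -> U m.

Lemma mono_ideal0 : mono_ideal 0.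
Proof. by move=> m; rewrite msupp0. Qed.

Lemma mono_idealD f g : mono_ideal f -> mono_ideal g -> mono_ideal (f + g).
Proof.
move=> hf hg m /msuppD_le; rewrite mem_cat => /orP[]; [exact: hf | exact: hg].
Qed.

Lemma mono_idealN f : mono_ideal f -> mono_ideal (- f).
Proof. by move=> hf m; rewrite (perm_mem (msuppN f)); apply: hf. Qed.

Lemma mono_idealB f g : mono_ideal f -> mono_ideal g -> mono_ideal (f - g).
Proof. by move=> hf hg; apply: mono_idealD => //; apply: mono_idealN. Qed.

Lemma mono_ideal_sum (I : Type) (r : seq I) (F : I -> S) :
  (forall i, mono_ideal (F i)) -> mono_ideal (\sum_(i <- r) F i).
Proof.
by move=> hF; apply: (big_ind mono_ideal) => //;
  [exact: mono_ideal0 | exact: mono_idealD].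
Qed.

Lemma mono_ideal_hcomp j f : mono_ideal f -> mono_ideal (hcomp j f).
Proof.
move=> hf m; rewrite mcoeff_msupp mcoeff_hcomp; case: ifP => [_ m0|_].
  by apply: hf; rewrite mcoeff_msupp.
by rewrite eqxx.
Qed.

Hypothesis U_up : forall m m', U m -> U (m + m')%MM.

Lemma mono_idealM a f : mono_ideal f -> mono_ideal (a * f).
Proof.
move=> hf m /msuppM_le /allpairsP[[m1 m2] /= [_ /hf m2U ->]].
by rewrite addmC; apply: U_up.
Qed.

Lemma mono_ideal_mx r (X : 'cV[S]_r) (v : 'rV[S]_r) :
  (forall i, mono_ideal (X i 0)) -> mono_ideal ((v *m X) 0 0).
Proof.
by move=> hX; rewrite mxE; apply: mono_ideal_sum => i; apply: mono_idealM.
Qed.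

End MonoIdeal.

(** Multiplication by a monomial translates the support injectively, so no terms cancel. Colon
    ideals by monomials are thus read off from exponents. *)
Lemma mono_idealXM U a (f : S) :
  mono_ideal U ('X_[a] * f) <-> mono_ideal (fun m => U (a + m)%MM) f.
Proof.
split=> hf m.
  rewrite mcoeff_msupp => m0; apply: hf.
  by rewrite mcoeff_msupp mulrC mcoeffMX.
by rewrite mulrC (perm_mem (msuppMX _ _)) => /mapP[m' /hf Um' ->].
Qed.

(** * Matrices of degree 0 between graded free modules with given shifts *)

Definition homog_mx a b (s : 'I_a -> int) (t : 'I_b -> int)
    (A : 'M[S]_(a, b)) :=
  forall i j, homog_of_deg (s i - t j) (A i j).

Definition hcomp_mx a b (s : 'I_a -> int) (t : 'I_b -> int)
    (A : 'M[S]_(a, b)) :=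
  \matrix_(i, j) hcomp (s i - t j) (A i j).

Lemma hcomp_mx_homog a b (s : 'I_a -> int) (t : 'I_b -> int) A :
  homog_mx s t (hcomp_mx s t A).
Proof. by move=> i j; rewrite mxE; apply: hcomp_homog. Qed.

Lemma hcomp_mx_id a b (s : 'I_a -> int) (t : 'I_b -> int) A :
  homog_mx s t A -> hcomp_mx s t A = A.
Proof. by move=> hA; apply/matrixP => i j; rewrite mxE hcomp_id. Qed.

(** This allows an arbitrary solution of a linear system with homogeneous data to be replaced by its
    homogeneous part. *)
Lemma hcomp_mxM a b c
    (s : 'I_a -> int) (t : 'I_b -> int) (u : 'I_c -> int) A D :
  homog_mx t u D -> hcomp_mx s u (A *m D) = hcomp_mx s t A *m D.
Proof.
move=> hD; apply/matrixP => i j; rewrite !mxE linear_sum.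
apply: eq_bigr => l _; rewrite mxE -(hcompM _ _ (hD l j)).
by congr (hcomp _ _); ring.
Qed.

Lemma homog_mxM a b c
    (s : 'I_a -> int) (t : 'I_b -> int) (u : 'I_c -> int) A D :
  homog_mx s t A -> homog_mx t u D -> homog_mx s u (A *m D).
Proof.
move=> hA hD; rewrite -(hcomp_mx_id hA) -(hcomp_mxM _ _ hD).
exact: hcomp_mx_homog.
Qed.

End MonomialIdeals.

(** * Minimal graded resolutions and mapping cones *)

Section GradedResolutions.
Variables (n : nat) (k : fieldType).
Local Notation S := {mpoly k[n]}.
Local Notation ideal := (@mono_ideal n k).

Definition upward (U : 'X_{1..n} -> Prop) := forall m m', U m -> U (m + m')%MM.

(** In degree 0 the outgoing map goes to S/I; its kernel is expressed by membership in the ideal,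
    which avoids the quotient module. *)
Definition is_cycle (U : 'X_{1..n} -> Prop) (rk : nat -> nat)
    (aug : 'cV[S]_(rk 0%N)) (df : forall i, 'M[S]_(rk i.+1, rk i)) i :
    'rV[S]_(rk i) -> Prop :=
  match i with
  | 0 => fun v => ideal U ((v *m aug) 0 0)
  | j.+1 => fun v => v *m df j = 0
  end.

(* A minimal graded free resolution of S/I, for I = mono_ideal U, whose
   augmentation sends a row vector v to the class of v *m aug. *)
Record graded_res (U : 'X_{1..n} -> Prop) := GradedRes {
  rk : nat -> nat;
  sh : forall i, 'I_(rk i) -> int;
  aug : 'cV[S]_(rk 0%N);
  df : forall i, 'M[S]_(rk i.+1, rk i);
  aug_surj : exists v : 'rV[S]_(rk 0), ideal U ((v *m aug) 0 0 - 1);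
  df_exact : forall i (v : 'rV[S]_(rk i)),
    is_cycle U aug df v <-> exists w, w *m df i = v;
  aug_homog : forall r, homog_of_deg (@sh 0%N r) (aug r 0);
  df_homog : forall i, homog_mx (@sh i.+1) (@sh i) (df i);
  df_min : forall i r c, (df i r c)@_0%MM = 0 }.

Definition res_cycle U (F : graded_res U) i : 'rV[S]_(rk F i) -> Prop :=
  @is_cycle U (rk F) (aug F) (df F) i.
Local Notation Z F := (@res_cycle _ F _).

(** * Homogeneous chain maps lifting multiplication by a polynomial of degree [e] *)

Section Lift.
Variables (U V : 'X_{1..n} -> Prop) (F : graded_res U) (G : graded_res V).
Hypothesis U_up : upward U.
Variable e : int.
Let t i (r : 'I_(rk G i)) : int := sh r + e.
Let s i : 'I_(rk F i) -> int := @sh _ F i.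

(** Exactness lifts each row of [df G i *m A] separately, without control of degrees. The
    homogeneous part of the result still solves the equation, because the right-hand side is
    homogeneous. *)
Lemma graded_lift i (A : 'M[S]_(rk G i, rk F i)) :
    homog_mx (@t i) (@s i) A -> (forall v, Z G v -> Z F (v *m A)) ->
  exists2 B : 'M[S]_(rk G i.+1, rk F i.+1), homog_mx (@t i.+1) (@s i.+1) B &
    B *m df F i = df G i *m A.
Proof.
move=> hA ZA.
have /choice[B BE] r : exists w, w *m df F i = row r (df G i *m A).
  apply/df_exact; rewrite row_mul; apply: ZA; apply/df_exact.
  by exists (delta_mx 0 r); rewrite rowE.
have BE' : \matrix_r B r *m df F i = df G i *m A.
  by apply/row_matrixP => r; rewrite row_mul rowK.
exists (hcomp_mx (@t i.+1) (@s i.+1) (\matrix_r B r)).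
  exact: hcomp_mx_homog.
rewrite -(hcomp_mxM _ _ (@df_homog _ F i)) BE'.
apply: hcomp_mx_id; apply: homog_mxM hA => r c.
by have := @df_homog _ G i r c; rewrite /t; congr homog_of_deg; ring.
Qed.

Lemma graded_lift0 (u : S) :
    homog_of_deg e u ->
  exists2 A : 'M[S]_(rk G 0, rk F 0), homog_mx (@t 0%N) (@s 0%N) A &
    forall v : 'rV_(rk G 0),
      ideal U ((v *m A *m aug F) 0 0 - u * (v *m aug G) 0 0).
Proof.
move=> hu; have [v1 v1E] := aug_surj F.
(* As [v1] augments to 1 modulo the ideal, the rank-one matrix [Y *m v1] followed by [aug F] agrees
   with [Y] modulo the ideal. Its homogeneous part keeps this property, since a monomial ideal
   contains the homogeneous components of its members. *)
pose Y := u *: aug G; pose A := Y *m v1.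
pose z (i : 'I_1) : int := 0.
have augF_homog : homog_mx (@s 0%N) z (aug F).
  by move=> r c; rewrite ord1 subr0; apply: aug_homog.
have Y_homog : homog_mx (@t 0%N) z Y.
  move=> r c; rewrite ord1 subr0 mxE /t addrC; apply: homogM hu _.
  exact: aug_homog.
pose X := A *m aug F - Y.
have XU r : ideal U (X r 0).
  have -> : X r 0 = (u * aug G r 0) * ((v1 *m aug F) 0 0 - 1).
    by rewrite /X /A -mulmxA !mxE big_ord1 /Y !mxE mulrBr mulr1.
  exact: mono_idealM.
exists (hcomp_mx (@t 0%N) (@s 0%N) A); first exact: hcomp_mx_homog.
move=> v; rewrite -mulmxA -(hcomp_mxM _ _ augF_homog).
have -> : A *m aug F = X + Y by rewrite subrK.
have -> : hcomp_mx (@t 0%N) z (X + Y) = hcomp_mx (@t 0%N) z X + Y.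
  rewrite -{2}(hcomp_mx_id Y_homog).
  by apply/matrixP => r c; rewrite !mxE linearD.
rewrite mulmxDr /Y -scalemxAr mxE [X in _ + X - _]mxE addrK.
by apply: mono_ideal_mx => // r; rewrite mxE; apply: mono_ideal_hcomp.
Qed.

Lemma graded_chain_map (u : S) :
    homog_of_deg e u -> (forall f, ideal V f -> ideal U (u * f)) ->
  exists A : forall i, 'M[S]_(rk G i, rk F i),
  [/\ forall i, homog_mx (@t i) (@s i) (A i),
      forall v : 'rV_(rk G 0),
        ideal U ((v *m A 0%N *m aug F) 0 0 - u * (v *m aug G) 0 0)
    & forall i, A i.+1 *m df F i = df G i *m A i].
Proof.
move=> hu uVU.
(* Preservation of cycles travels with each matrix, because [graded_lift] asks for it at the next
   step; [cid2] turns the lifts into data for the recursion. *)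
pose T i := {A : 'M[S]_(rk G i, rk F i) |
  homog_mx (@t i) (@s i) A /\ forall v, Z G v -> Z F (v *m A)}.
have [A0 hA0 A0E] := graded_lift0 hu.
have ZA0 v : Z G v -> Z F (v *m A0).
  move=> /= /uVU vG; rewrite -[X in ideal U X](subrK (u * (v *m aug G) 0 0)).
  by apply: mono_idealD.
have step i (A : T i) : {B : T i.+1 | sval B *m df F i = df G i *m sval A}.
  case: A => A [hA ZA] /=.
  have [B hB BE] := cid2 (graded_lift hA ZA).
  have ZB v : Z G v -> Z F (v *m B).
    by move=> /= vG; rewrite -mulmxA BE mulmxA vG mul0mx.
  by exists (exist _ B (conj hB ZB)).
pose A := nat_rect T (exist _ A0 (conj hA0 ZA0)) (fun i A => sval (step i A)).
exists (fun i => sval (A i)); split=> // i.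
- by case: (svalP (A i)).
- exact: (svalP (step i (A i))).
Qed.

End Lift.

(** * The mapping cone: from resolutions of S/I and S/(I : u) to one of S/(I + (u)), for a monomial
    u with exponent [a] *)

Section Cone.
Variables (U K V : 'X_{1..n} -> Prop) (x : 'I_n) (b : 'X_{1..n}).
Hypothesis U_up : upward U.
Let a := (U_(x) + b)%MM.
Hypothesis colon_b : forall m, K m <-> U (b + m)%MM.
Hypothesis colon_a : forall m, K m <-> U (a + m)%MM.
Hypothesis VE : forall m, V m <-> U m \/ (a <= m)%MM.

Lemma colon_bP f : ideal K f <-> ideal U ('X_[b] * f).
Proof.
by rewrite mono_idealXM; split=> h m /h /colon_b.
Qed.

Lemma colon_aP f : ideal K f <-> ideal U ('X_[a] * f).
Proof.
by rewrite mono_idealXM; split=> h m /h /colon_a.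
Qed.

Lemma ideal_sumP f : ideal V f <-> exists c, ideal U (f - 'X_[a] * c).
Proof.
split=> [hf | [c hc] m].
  (* The witness collects the quotients by ['X_[a]] of the terms that it divides; every other term
     of [f] lies in the smaller ideal. *)
  exists (\sum_(m <- msupp f | (a <= m)%MM) f@_m *: 'X_[m - a]).
  rewrite {1}(mpolyE f) (bigID (fun m => (a <= m)%MM)) /= mulr_sumr.
  have -> : \sum_(m <- msupp f | (a <= m)%MM) 'X_[a] * (f@_m *: 'X_[m - a]) =
            \sum_(m <- msupp f | (a <= m)%MM) f@_m *: 'X_[m] :> S.
    apply: eq_bigr => m am; rewrite -scalerAr -mpolyXD addmC submK //.
  rewrite addrAC subrr add0r big_seq_cond; apply: (big_ind (ideal U)).
  - exact: mono_ideal0.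
  - exact: mono_idealD.
  move=> m /andP[/hf /VE[Um|->//] _] m' /msuppZ_le.
  by rewrite msuppX inE => /eqP ->.
rewrite -[f](subrK ('X_[a] * c)) => /msuppD_le; rewrite mem_cat.
move=> /orP[/hc Um|].
  by apply/VE; left.
rewrite mulrC (perm_mem (msuppMX _ _)) => /mapP[m' _ ->].
by apply/VE; right; apply: lem_addr.
Qed.

Variables (F : graded_res U) (G : graded_res K).
Variable phi : forall i, 'M[S]_(rk G i, rk F i).
Let e : int := (mdeg a)%:Z.
Hypothesis phi_homog : forall i,
  homog_mx (fun r : 'I_(rk G i) => sh r + e) (@sh _ F i) (phi i).
Hypothesis phi_aug : forall v : 'rV_(rk G 0),
  ideal U ((v *m phi 0%N *m aug F) 0 0 - 'X_[a] * (v *m aug G) 0 0).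
Hypothesis phi_df : forall i, phi i.+1 *m df F i = df G i *m phi i.
Hypothesis phi_min : forall i r c, (phi i r c)@_0%MM = 0.

Definition cone_rk i : nat :=
  if i is j.+1 then (rk F j.+1 + rk G j)%N else rk F 0.

Definition cone_sh i : 'I_(cone_rk i) -> int :=
  match i with
  | 0 => @sh _ F 0
  | j.+1 => fun r =>
      match split r with inl r' => sh r' | inr r' => sh r' + e end
  end.

(** On row vectors, (v1, v2) goes to (v1 d_F + v2 phi, - v2 d_G). The sign makes consecutive maps
    compose to 0; in degree 0 there is no summand from [G]. *)
Definition cone_df i : 'M[S]_(cone_rk i.+1, cone_rk i) :=
  match i with
  | 0 => col_mx (df F 0) (phi 0)
  | j.+1 => block_mx (df F j.+1) 0 (phi j.+1) (- df G j)
  end.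

(** Degree 0 uses that [V] is [U] enlarged by the multiples of [a]; degree 1 uses that
    multiplication by ['X_[a]] is injective from S/(I : u) to S/I; above that it is the usual
    diagram chase. *)
Lemma cone_exact i (v : 'rV[S]_(cone_rk i)) :
  @is_cycle V cone_rk (aug F) cone_df i v <-> exists w, w *m cone_df i = v.
Proof.
have exF j := @df_exact _ F j; have exG j := @df_exact _ G j.
case: i v => [|[|i]] v /=.
- split=> [/ideal_sumP[c hc]|[w <-]].
    have [v1 v1E] := aug_surj G.
    (* The vector [v] augments to ['X_[a] * c] modulo the ideal of [U], and [c *: v1] augments to
       [c] modulo that of [K]; through [phi] the two contributions cancel. *)
    have : Z F (v - (c *: v1) *m phi 0%N).
      rewrite /res_cycle /=; have := @phi_aug (c *: v1).
      set y := (_ *m aug F) 0 0; rewrite -scalemxAl [X in _ - _ * X]mxE => hy.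
      have -> : ((v - c *: v1 *m phi 0%N) *m aug F) 0 0 =
        ((v *m aug F) 0 0 - 'X_[a] * c) -
        ((y - 'X_[a] * (c * (v1 *m aug G) 0 0))
        + 'X_[a] * c * ((v1 *m aug G) 0 0 - 1)).
        rewrite mulmxBl mxE [X in _ + X]mxE -/y; ring.
      apply: mono_idealB => //; apply: mono_idealD => //.
      rewrite -mulrA; apply/colon_aP; apply: mono_idealM => // m m'.
      rewrite !colon_a; rewrite addmA; exact: U_up.
    move=> /exF[w1 w1E]; exists (row_mx w1 (c *: v1)).
    by rewrite mul_row_col w1E subrK.
  rewrite -[w]hsubmxK mul_row_col mulmxDl mxE; apply/ideal_sumP.
  exists ((rsubmx w *m aug G) 0 0); rewrite -addrA; apply: mono_idealD => //.
  by apply/(exF 0%N); exists (lsubmx w).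
- rewrite -[v]hsubmxK; move: (lsubmx v) (rsubmx v) => {v} v1 v2.
  rewrite mul_row_col; split=> [vE|[w]]; last first.
    rewrite -[w]hsubmxK mul_row_block mulmx0 add0r => /eq_row_mx[<- <-].
    rewrite mulmxDl -!mulmxA phi_df.
    have -> : lsubmx w *m (df F 1 *m df F 0) = 0.
      by rewrite mulmxA; apply/(exF 1%N); exists (lsubmx w).
    by rewrite mulNmx mulmxN add0r subrr.
  (* By [vE], [v2 *m phi 0] is a boundary of [F] up to sign and so augments into the ideal. Hence so
     does ['X_[a]] times the augmentation of [v2], and the colon condition gives the claim. *)
  have : Z G v2.
    apply/colon_aP; have := @phi_aug v2.
    have -> : v2 *m phi 0%N = - (v1 *m df F 0).
      by rewrite -[RHS]add0r -vE addrC addKr.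
    move/mono_idealN; rewrite opprB => h.
    rewrite -[X in ideal U X](subrK ((- (v1 *m df F 0) *m aug F) 0 0)).
    apply: mono_idealD => //; rewrite mulNmx mxE; apply: mono_idealN.
    by apply/(exF 0%N); exists v1.
  move=> /exG[w2 w2E].
  have : Z F (v1 + w2 *m phi 1%N).
    by rewrite /res_cycle /= mulmxDl -mulmxA phi_df mulmxA w2E.
  move=> /exF[w1 w1E]; exists (row_mx w1 (- w2)).
  rewrite mul_row_block mulmx0 add0r w1E !mulNmx mulmxN opprK w2E.
  by rewrite addrK.
- rewrite -[v]hsubmxK; move: (lsubmx v) (rsubmx v) => {v} v1 v2.
  rewrite mul_row_block mulmx0 add0r; split=> [|[w]]; last first.
    rewrite -[w]hsubmxK mul_row_block mulmx0 add0r => /eq_row_mx[<- <-].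
    rewrite mulmxDl -!mulmxA phi_df.
    have -> : lsubmx w *m (df F i.+2 *m df F i.+1) = 0.
      by rewrite mulmxA; apply/(exF i.+2); exists (lsubmx w).
    rewrite !mulNmx !mulmxN opprK add0r subrr.
    have -> : rsubmx w *m (df G i.+1 *m df G i) = 0.
      by rewrite mulmxA; apply/(exG i.+1); exists (rsubmx w).
    by rewrite row_mx0.
  rewrite -(row_mx0 _ _ (rk F i.+1)) => /eq_row_mx[v1E v2E].
  have : Z G v2.
    by rewrite /res_cycle /=; apply: oppr_inj; rewrite -mulmxN v2E oppr0.
  move=> /exG[w2 w2E].
  have : Z F (v1 + w2 *m phi i.+2).
    by rewrite /res_cycle /= mulmxDl -mulmxA phi_df mulmxA w2E.
  move=> /exF[w1 w1E]; exists (row_mx w1 (- w2)).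
  rewrite mul_row_block mulmx0 add0r w1E !mulNmx mulmxN opprK w2E.
  by rewrite addrK.
Qed.

Lemma cone_homog i : homog_mx (@cone_sh i.+1) (@cone_sh i) (cone_df i).
Proof.
case: i => [|i] r c; rewrite /cone_sh /cone_df.
  rewrite mxE; case: splitP => r' _; first exact: df_homog.
  exact: phi_homog.
rewrite mxE; case: splitP => r' _; rewrite mxE; case: splitP => c' _.
- exact: df_homog.
- by rewrite mxE; apply: homog0.
- exact: phi_homog.
- rewrite mxE; apply: homogN; have := @df_homog _ G i r' c'.
  by congr homog_of_deg; ring.
Qed.

Lemma cone_min i r c : (cone_df i r c)@_0%MM = 0.
Proof.
case: i r c => [|i] r c; rewrite /cone_df !mxE; case: splitP => r' _.
- exact: df_min.
- exact: phi_min.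
- by rewrite mxE; case: splitP => c' _; [apply: df_min | rewrite mxE mcoeff0].
rewrite mxE; case: splitP => c' _; first exact: phi_min.
by rewrite mxE mcoeffN df_min oppr0.
Qed.

Lemma cone_aug_surj :
  exists v : 'rV[S]_(rk F 0), ideal V ((v *m aug F) 0 0 - 1).
Proof.
have [v hv] := aug_surj F; exists v; apply/ideal_sumP.
by exists 0; rewrite mulr0 subr0.
Qed.

Definition cone : graded_res V :=
  @GradedRes V cone_rk cone_sh (aug F) cone_df cone_aug_surj cone_exact
    (@aug_homog _ F) cone_homog cone_min.

End Cone.

(* The resolution computes regularity rho and projective dimension l. *)
Definition res_numbers U (F : graded_res U) (rho l : nat) : Prop :=
  [/\ forall i (r : 'I_(rk F i)), sh r <= (i + rho)%N%:Z,
      exists i (r : 'I_(rk F i)), sh r = (i + rho)%N%:Z,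
      forall i, (l < i)%N -> rk F i = 0%N
    & rk F l <> 0%N].

Definition resolved U (rho l : nat) : Prop :=
  upward U /\ exists F : graded_res U, res_numbers F rho l.

(** A generator of [G] moves up one homological degree while its shift grows by [mdeg b + 1], so it
    contributes [mdeg b] more to the regularity and 1 more to the length. The generators of [F] are
    unchanged. *)
Lemma resolved_cone U K V x b r1 l1 r2 l2 :
    resolved U r1 l1 -> resolved K r2 l2 ->
    (forall m, K m <-> U (b + m)%MM) ->
    (forall m, K m <-> U (U_(x) + b + m)%MM) ->
    (forall m, V m <-> U m \/ (U_(x) + b <= m)%MM) ->
  resolved V (maxn r1 (r2 + mdeg b)) (maxn l1 l2.+1).
Proof.
move=> [U_up [F [F_le [i1 [s1 s1E]] F_l F_l0]]].
move=> [K_up [G [G_le [i2 [s2 s2E]] G_l G_l0]]].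
move=> Kb Ka VE; split.
  move=> m m' /VE[Um|am]; apply/VE; [by left; apply: U_up|right].
  by apply: lepm_trans am _; apply: lem_addr.
have [psi [psi_homog psi_aug psi_df]] :=
  graded_chain_map F G U_up (@homogX n k b) (fun f => proj1 (colon_bP Kb f)).
(* The factor 'X_x makes the cone minimal. *)
pose phi i := 'X_x *: psi i.
have phi_homog i : homog_mx
    (fun r : 'I_(rk G i) => sh r + (mdeg (U_(x) + b)%MM)%:Z)
    (@sh _ F i) (phi i).
  move=> r c; rewrite mxE mdegD mdeg1.
  have := homogM (@homogX n k U_(x)) (psi_homog i r c).
  by rewrite mdeg1 PoszD; congr homog_of_deg; ring.
have phi_aug (v : 'rV_(rk G 0)) : ideal U
    ((v *m phi 0%N *m aug F) 0 0 - 'X_[U_(x) + b] * (v *m aug G) 0 0).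
  rewrite /phi -scalemxAr -scalemxAl mxE mpolyXD -mulrA -mulrBr.
  exact: mono_idealM.
have phi_df i : phi i.+1 *m df F i = df G i *m phi i.
  by rewrite /phi -scalemxAl psi_df scalemxAr.
have phi_min i r c : (phi i r c)@_0%MM = 0.
  by rewrite mxE rmorphM /= mcoeffX -mdeg_eq0 mdeg1 mul0r.
exists (cone U_up Ka VE phi_homog phi_aug phi_df phi_min).
have dE : mdeg (U_(x) + b)%MM = (mdeg b).+1 by rewrite mdegD mdeg1.
split=> /=.
- case=> [|i] r /=; first by have := F_le 0%N r; lia.
  rewrite dE; case: splitP => r' _; first by have := F_le _ r'; lia.
  by have := G_le _ r'; lia.
- case: (leqP (r2 + mdeg b) r1) => le_r.
    case: i1 s1 s1E => [|i] s1 s1E; first by exists 0%N, s1.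
    by exists i.+1, (lshift _ s1) => /=; rewrite (unsplitK (inl s1)).
  exists i2.+1, (rshift _ s2) => /=.
  by rewrite (unsplitK (inr s2)) s2E dE; lia.
- by case=> [|i] //; rewrite gtn_max => /andP[hF hG] /=; rewrite F_l // G_l.
- case: (leqP l2.+1 l1) => le_l /=; last by lia.
  by case: (l1) le_l F_l0 => //=; lia.
Qed.

Lemma resolved0 : resolved (fun=> False) 0 0.
Proof.
split=> //.
pose rk0 i : nat := (i == 0%N).
pose sh0 i (r : 'I_(rk0 i)) : int := 0.
pose aug0 : 'cV[S]_(rk0 0%N) := 1%:M.
pose df0 i : 'M[S]_(rk0 i.+1, rk0 i) := 0.
have mem0 f : ideal (fun=> False) f <-> f = 0.
  split=> [hf|-> m]; last by rewrite msupp0.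
  apply/msuppnil0; case suppf: (msupp f) => [//|m s].
  by have := hf m; rewrite suppf mem_head => /(_ isT).
have exact0 i (v : 'rV_(rk0 i)) :
    @is_cycle (fun=> False) rk0 aug0 df0 i v <-> exists w, w *m df0 i = v.
  case: i v => [|i] v /=.
    rewrite mem0 mulmx1; split=> [v0|[w <-]]; last by rewrite mulmx0 mxE.
    by exists 0; rewrite mulmx0; apply/rowP => j; rewrite !ord1 v0 mxE.
  split=> _; last by rewrite mulmx0.
  by exists 0; apply/rowP => -[].
have surj0 : exists v : 'rV[S]_(rk0 0%N),
    ideal (fun=> False) ((v *m aug0) 0 0 - 1).
  by exists 1%:M; apply/mem0; rewrite mulmx1 mxE subrr.
have augh r : homog_of_deg (@sh0 0%N r) (aug0 r 0).
  by rewrite !ord1 mxE eqxx; apply: homog1.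
have dfh i : homog_mx (@sh0 i.+1) (@sh0 i) (df0 i) by case.
have df_min0 i r c : (df0 i r c)@_0%MM = 0 by case: r.
exists (@GradedRes (fun=> False) rk0 sh0 aug0 df0
  surj0 exact0 augh dfh df_min0).
split=> //=.
- by exists 0%N, ord0.
- by case.
Qed.

Lemma resolved_ext U V rho l :
  (forall m, U m <-> V m) -> resolved U rho l -> resolved V rho l.
Proof. by move=> UV; have -> : U = V by apply/funext => m; apply/propext. Qed.

End GradedResolutions.

(** * The recursion for the square of a path *)

(* Here and below P is the support of a monomial: has_window m describes the
   monomials of J_m, covers_nbhd m those of N_m, and adding the range [s, t) to
   P amounts to a colon by x_s ... x_(t-1). *)
Definition has_window (m : nat) (P : nat -> bool) : Prop :=
  ((3 <= m)%N /\ forall j, (j < 3)%N -> P j) \/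
  (exists i, [/\ (1 <= i)%N, (i + 5 <= m)%N &
    forall j, (i <= j < i + 5)%N -> P j]).

Definition covers_nbhd (m : nat) (P : nat -> bool) : Prop :=
  exists c, (c < m)%N /\
    forall j, (j < m)%N -> (c <= j + 2)%N -> (j <= c + 2)%N -> P j.

Definition add_range (s t : nat) (P : nat -> bool) : nat -> bool :=
  fun i => P i || (s <= i < t)%N.

Lemma has_window_small m P : (m <= 2)%N -> ~ has_window m P.
Proof. by move=> m2 [[]|[i []]]; lia. Qed.

(** A generator of J_(q+5) that is not in J_q involves x_q; conversely, one of them consists of x_q
    and variables that are in the added range or come after x_q. Leaving [t] free covers the colon
    by v and the colon by v without its last variable. *)
Lemma has_window_colon q t P :
  (q + 5 <= t)%N ->
  has_window q P \/ P q <-> has_window (q + 5) (add_range q.+1 t P).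
Proof.
move=> le_t; rewrite /add_range; split=> [[[[q3 P3]|[i [i1 iq Pi]]]|Pq]|].
- by left; split=> [|j /P3 ->]; first lia.
- by right; exists i; split=> [||j /Pi ->]; rewrite //; lia.
- have Pj j : (q <= j < q + 5)%N -> P j || (q.+1 <= j < t)%N.
    move=> lt_j; have [->|ne] := eqVneq j q; first by rewrite Pq.
    by apply/orP; right; lia.
  (* A window of length 5 must start at 1 or later, so for [q = 0] the initial triple takes its
     place. *)
  have [q0|q0] := posnP q; [left | right; exists q].
    by split=> [|j lt_j]; [lia | apply: Pj; lia].
  by split=> //; lia.
move=> [[_ P3]|[i [i1 iq Pi]]].
  have [q3|q3] := leqP 3 q.
    by left; left; split=> // j lt_j; case/orP: (P3 j lt_j) => //; lia.
  by right; case/orP: (P3 q q3) => //; lia.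
have [lt_iq|lt_iq] := leqP (i + 5) q.
  by left; right; exists i; split=> // j lt_j; case/orP: (Pi j lt_j) => //; lia.
right; have /orP[//|] : P q || (q.+1 <= q < t)%N by apply: Pi; lia.
lia.
Qed.

Lemma has_window_succ q P :
  has_window (q + 6) P <->
  has_window (q + 5) P \/ (forall j, (q.+1 <= j < q + 6)%N -> P j).
Proof.
split=> [[[_ P3]|[i [i1 iq Pi]]]|[[[_ P3]|[i [i1 iq Pi]]]|Pq]].
- by left; left; split=> //; lia.
- have [lt_iq|lt_iq] := leqP (i + 5) (q + 5).
    by left; right; exists i.
  by right=> j lt_j; apply: Pi; lia.
- by left; split=> //; lia.
- by right; exists i; split=> //; lia.
- by right; exists q.+1; split=> [||j lt_j]; first lia; [lia | apply: Pq; lia].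
Qed.

Lemma has_window_3_5 m P :
  (3 <= m <= 5)%N -> has_window m P <-> forall j, (j < 3)%N -> P j.
Proof.
move=> lt_m; split=> [[[]//|[i []]]|P3]; first by lia.
by left; split=> //; lia.
Qed.

(** Cut down to the first [q] variables, the window starting at [i] is the closed neighborhood of
    vertex [i + 2], and the initial triple is that of vertex 0. The neighborhoods of vertices 1 and
    2 contain that of vertex 0. *)
Lemma covers_nbhd_colon q t P :
  (q + 2 <= t)%N -> covers_nbhd q P <-> has_window (q + 2) (add_range q t P).
Proof.
move=> le_t; rewrite /add_range; split=> [[c [lt_c Pc]]|].
  have [c2|c2] := leqP c 2.
    left; split=> [|j lt_j]; first by lia.
    have [lt_jq|lt_jq] := ltnP j q; first by rewrite Pc //; lia.
    by apply/orP; right; lia.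
  right; exists (c - 2)%N; split=> [||j lt_j]; try lia.
  have [lt_jq|lt_jq] := ltnP j q; first by rewrite Pc //; lia.
  by apply/orP; right; lia.
move=> [[q3 P3]|[i [i1 iq Pi]]].
  exists 0%N; split=> [|j lt_j _ le_j]; first by lia.
  by have /orP[//|] : P j || (q <= j < t)%N by [apply: P3; lia]; lia.
exists (i + 2)%N; split=> [|j lt_j ge_j le_j]; first by lia.
by have /orP[//|] : P j || (q <= j < t)%N by [apply: Pi; lia]; lia.
Qed.

(** The neighborhoods of the last three vertices all contain the last triple, which is the
    neighborhood of vertex [q + 2]. Those of earlier vertices are windows of length 5 or contain the
    initial triple. *)
Lemma covers_nbhd_succ q P :
  covers_nbhd (q + 3) P <->
  has_window (q + 2) P \/ (forall j, (q <= j < q + 3)%N -> P j).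
Proof.
split=> [[c [lt_c Pc]]|[[[q3 P3]|[i [i1 iq Pi]]]|Pq]].
- have [le_qc|lt_cq] := leqP q c.
    by right=> j lt_j; apply: Pc; lia.
  left; have [c2|c2] := leqP c 2.
    by left; split=> [|j lt_j]; [lia | apply: Pc; lia].
  by right; exists (c - 2)%N; split=> [||j lt_j]; [lia | lia | apply: Pc; lia].
- by exists 0%N; split=> [|j lt_j _ le_j]; [lia | apply: P3; lia].
- by exists (i + 2)%N; split=> [|j lt_j ge_j le_j]; [lia | apply: Pi; lia].
- by exists (q + 2)%N; split=> [|j lt_j ge_j le_j]; [lia | apply: Pq; lia].
Qed.

(** * Solving the recursions for ideals described by supports *)

Section SupportIdeals.
Variables (n : nat) (k : fieldType).

Definition msup (m : 'X_{1..n}) (i : nat) : bool := nth 0%N m i != 0%N.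

Definition range_mnm (s t : nat) : 'X_{1..n} :=
  [multinom ((s <= i < t)%N : nat) | i < n].

Lemma msup_ord m (i : 'I_n) : msup m i = (m i != 0%N).
Proof. by rewrite /msup (mnm_nth 0%N). Qed.

Lemma msup_ge m i : (n <= i)%N -> msup m i = false.
Proof. by move=> ni; rewrite /msup nth_default // size_tuple. Qed.

Lemma msup_range m s t :
  (t <= n)%N -> msup (range_mnm s t + m)%MM = add_range s t (msup m).
Proof.
move=> tn; apply/funext => i; rewrite /add_range.
have [lt_i|le_i] := ltnP i n; last by rewrite !msup_ge //; lia.
by rewrite -[i]/(nat_of_ord (Ordinal lt_i)) !msup_ord mnmDE mnmE; lia.
Qed.

Lemma range_le m s t : (t <= n)%N ->
  (range_mnm s t <= m)%MM <-> forall i, (s <= i < t)%N -> msup m i.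
Proof.
move=> tn; split=> [/mnm_lepP le_m i sit | Hm].
  have lt_i : (i < n)%N by lia.
  have := msup_ord m (Ordinal lt_i); rewrite /= => ->.
  by have := le_m (Ordinal lt_i); rewrite mnmE /= sit lt0n.
apply/mnm_lepP => i; rewrite mnmE; have := Hm i; rewrite msup_ord.
by case: (_ <= _ < _)%N => // /(_ isT); lia.
Qed.

Lemma range_mnmS (x : 'I_n) s :
  (s <= x)%N -> (U_(x) + range_mnm s x)%MM = range_mnm s x.+1.
Proof.
move=> sx; apply/mnmP => i; rewrite mnmDE mnm1E !mnmE -val_eqE /=; lia.
Qed.

Lemma mdeg_range s t : (s <= t <= n)%N -> mdeg (range_mnm s t) = (t - s)%N.
Proof.
have range0 r : range_mnm r r = 0%MM.
  by apply/mnmP => i; rewrite mnmE mnm0E; lia.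
move=> /andP[]; elim: t => [|t IHt].
  by rewrite leqn0 => /eqP -> _; rewrite range0 mdeg0.
rewrite leq_eqVlt => /orP[/eqP <- tn|st tn].
  by rewrite range0 mdeg0 subnn.
by rewrite -(range_mnmS (x := Ordinal tn)) //= mdegD mdeg1 IHt; lia.
Qed.

Definition resolved_sup (A : (nat -> bool) -> Prop) rho l : Prop :=
  resolved k (fun m : 'X_{1..n} => A (msup m)) rho l.

Lemma resolved_sup_ext (A B : (nat -> bool) -> Prop) rho l :
  (forall P, A P <-> B P) -> resolved_sup A rho l -> resolved_sup B rho l.
Proof. by move=> AB; apply: resolved_ext => m; apply: AB. Qed.

(** The cone for u = x_s ... x_x with its last variable split off: the two conditions on [B] are the
    colons by u' and by u, and [x - s] is the degree of u'. *)
Lemma resolved_sup_cone (A B C : (nat -> bool) -> Prop) s x r1 l1 r2 l2 :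
    (s <= x < n)%N -> resolved_sup A r1 l1 -> resolved_sup B r2 l2 ->
    (forall P, B P <-> A (add_range s x P)) ->
    (forall P, B P <-> A (add_range s x.+1 P)) ->
    (forall P, C P <-> A P \/ forall j, (s <= j < x.+1)%N -> P j) ->
  resolved_sup C (maxn r1 (r2 + (x - s))) (maxn l1 l2.+1).
Proof.
move=> /andP[sx xn] resA resB Bx Bx1 CE.
rewrite -(mdeg_range (s := s)); last by lia.
apply: (resolved_cone (x := Ordinal xn) resA resB) => m.
- by rewrite msup_range ?Bx //; lia.
- by rewrite (range_mnmS (x := Ordinal xn)) // msup_range ?Bx1.
- by rewrite (range_mnmS (x := Ordinal xn)) // CE range_le.
Qed.

Lemma resolved_sup0 (A : (nat -> bool) -> Prop) :
  (forall P, ~ A P) -> resolved_sup A 0 0.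
Proof.
by move=> A0; apply: (resolved_ext _ (resolved0 n k)) => m; split=> // /A0.
Qed.

(** The ideal is principal: it comes from one cone over the zero ideal, whose colon ideal is again
    zero. *)
Lemma resolved_sup_range s x : (s <= x < n)%N ->
  resolved_sup (fun P => forall j, (s <= j < x.+1)%N -> P j) (x - s) 1.
Proof.
move=> sxn; have r0 := @resolved_sup0 (fun=> False) (fun=> id).
have := resolved_sup_cone
  (C := fun P => forall j, (s <= j < x.+1)%N -> P j) sxn r0 r0.
by rewrite max0n add0n; apply=> // P; split; [right | case].
Qed.

Lemma resolved_has_window m : (m <= n)%N ->
  resolved_sup (has_window m) (2 * (m %/ 3)) (m %/ 3).
Proof.
elim/ltn_ind: m => m IH mn.
have [m2|m3] := leqP m 2.
  by rewrite divn_small //; apply: resolved_sup0 => P; apply: has_window_small.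
have [m5|m6] := leqP m 5.
  have -> : (m %/ 3 = 1)%N by lia.
  apply: (resolved_sup_ext _ (@resolved_sup_range 0 2 _)); last by lia.
  by move=> P; apply: iff_sym; apply: has_window_3_5; lia.
have [q mE] : exists q, m = (q + 6)%N by exists (m - 6)%N; lia.
rewrite {m}mE in IH mn m3 m6 *.
have resJq := IH q ltac:(lia) ltac:(lia).
have resJ5 := IH (q + 5)%N ltac:(lia) ltac:(lia).
(* J_q + (x_q) is itself a cone, with u = x_q and u' = 1: it adds nothing to the regularity and 1 to
   the length. By [addJ] the colon ideal is J_q, since x_q occurs in none of its generators. *)
have resK : resolved_sup (fun P => has_window q P \/ P q)
    (2 * (q %/ 3)) (q %/ 3).+1.
  have -> : (2 * (q %/ 3) =
    maxn (2 * (q %/ 3)) (2 * (q %/ 3) + (q - q)))%N by lia.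
  have -> : (q %/ 3).+1 = maxn (q %/ 3) (q %/ 3).+1 by lia.
  have addJ t P : has_window q P <-> has_window q (add_range q t P).
    have eqPj j : (j < q)%N -> add_range q t P j = P j.
      by move=> jq; rewrite /add_range; case: (P j) => //=; lia.
    split; case=> [[q3 P3]|[i [i1 iq Pi]]];
      [left; split=> // j lt_j|right; exists i; split=> // j lt_j|
       left; split=> // j lt_j|right; exists i; split=> // j lt_j].
    - by rewrite eqPj ?P3 //; lia.
    - by rewrite eqPj ?Pi //; lia.
    - by rewrite -eqPj ?P3 //; lia.
    - by rewrite -eqPj ?Pi //; lia.
  apply: (resolved_sup_cone _ resJq resJq) => //; first by lia.
  move=> P; split; case=> [HJ|Pq]; [by left | right=> j lt_j | by left | right].
    by have -> : j = q by lia.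
  by apply: Pq; lia.
have := resolved_sup_cone (C := has_window (q + 6)) _ resJ5 resK.
(* The new generator is v, with last variable x_(q+5); the remaining factor has degree 4. *)
move=> /(_ q.+1 (q + 5)%N); rewrite -addnS.
have -> : (maxn (2 * ((q + 5) %/ 3)) (2 * (q %/ 3) + (q + 5 - q.+1)) =
  2 * ((q + 6) %/ 3))%N by lia.
have -> : (maxn ((q + 5) %/ 3) (q %/ 3).+2 = (q + 6) %/ 3)%N by lia.
by apply=> [|P|P|P]; rewrite ?has_window_succ // -?has_window_colon //; lia.
Qed.

Lemma resolved_covers_nbhd m : (m <= n)%N ->
  resolved_sup (covers_nbhd m) ((2 * m) %/ 3) ((m + 2) %/ 3).
Proof.
elim/ltn_ind: m => m IH mn.
have [m2|m3] := leqP m 2.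
  case: m m2 mn {IH} => [|m] m2 mn.
    by apply: resolved_sup0 => P [c []].
  (* On one or two vertices the graph is complete, and the ideal is generated by the product of all
     variables. *)
  have -> : (2 * m.+1 %/ 3 = m - 0)%N by lia.
  have -> : ((m.+1 + 2) %/ 3 = 1)%N by lia.
  apply: (resolved_sup_ext _ (@resolved_sup_range 0 m _)) => //.
  move=> P; split=> [Pm|[c [lt_c Pc]] j lt_j]; last by apply: Pc; lia.
  by exists 0%N; split=> // j lt_j _ _; apply: Pm.
have [q mE] : exists q, m = (q + 3)%N by exists (m - 3)%N; lia.
rewrite {m m3}mE in IH mn *.
have resN := IH q ltac:(lia) ltac:(lia).
have resJ := @resolved_has_window (q + 2)%N ltac:(lia).
have := resolved_sup_cone (C := covers_nbhd (q + 3)) _ resJ resN.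
(* The new generator is w, with last variable x_(q+2); the remaining factor has degree 2. *)
move=> /(_ q (q + 2)%N); rewrite -addnS.
have -> : (maxn (2 * ((q + 2) %/ 3)) (2 * q %/ 3 + (q + 2 - q)) =
  2 * (q + 3) %/ 3)%N by lia.
have -> : (maxn ((q + 2) %/ 3) ((q + 2) %/ 3).+1 = (q + 3 + 2) %/ 3)%N by lia.
by apply=> [|P|P|P]; rewrite ?covers_nbhd_succ // -?covers_nbhd_colon //; lia.
Qed.

End SupportIdeals.

(** * Invariance of shifts and lengths *)

Lemma row_projective (R : comNzRingType) (a : nat) : projective 'rV[R]_a.
Proof.
move=> A B q f q_surj.
have /choice[y yE] (r : 'I_a) := q_surj (f (delta_mx 0 r)).
pose h (v : 'rV[R]_a) : A := \sum_r v 0 r *: y r.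
have h_lin : linear h.
  move=> c u v; rewrite /h scaler_sumr -big_split /=.
  by apply: eq_bigr => r _; rewrite !mxE scalerDl scalerA.
pose h' : {linear 'rV[R]_a -> A} :=
  HB.pack h (GRing.isLinear.Build _ _ _ _ h h_lin).
exists h' => v /=.
rewrite /h [in RHS](row_sum_delta v) !linear_sum.
by apply: eq_bigr => r _; rewrite !linearZ yE.
Qed.

Section Invariance.
Variables (n : nat) (k : fieldType).
Local Notation S := {mpoly k[n]}.
Variable U : 'X_{1..n} -> Prop.
Hypothesis U_up : upward U.

Definition in_max_ideal a (v : 'rV[S]_a) : Prop := forall c, (v 0 c)@_0%MM = 0.

Lemma in_max_idealD a (u v : 'rV[S]_a) :
  in_max_ideal u -> in_max_ideal v -> in_max_ideal (u + v).
Proof. by move=> hu hv c; rewrite mxE mcoeffD hu hv addr0. Qed.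

Lemma in_max_ideal_lin a b (f : {linear 'rV[S]_a -> 'rV[S]_b}) v :
  in_max_ideal v -> in_max_ideal (f v).
Proof.
move=> hv c; rewrite -mul_rV_lin1 mxE raddf_sum big1 //= => r _.
by rewrite rmorphM /= hv mul0r.
Qed.

Definition res_mod (F : graded_res k U) i : lmodType S := 'rV[S]_(rk F i).
Definition res_diff (F : graded_res k U) i :
    {linear res_mod F i.+1 -> res_mod F i} :=
  mulmxr (df F i).

Lemma res_diff_min (F : graded_res k U) i (x : res_mod F i.+1) :
  @in_max_ideal (rk F i) (res_diff F i x).
Proof.
move=> c; rewrite mxE raddf_sum big1 //= => r _.
by rewrite rmorphM /= df_min mulr0.
Qed.

Lemma res_cycle_diff (F : graded_res k U) i (x : res_mod F i.+1) :
  res_cycle (res_diff F i x).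
Proof. by apply/df_exact; exists x. Qed.

Lemma res_lift (F : graded_res k U) i (P : lmodType S)
    (f : {linear P -> res_mod F i}) :
    projective P -> (forall x, @res_cycle _ _ _ F i (f x)) ->
  exists h : {linear P -> res_mod F i.+1}, forall x, res_diff F i (h x) = f x.
Proof.
move=> projP fZ; apply: projective_lift => // x.
by have /df_exact[w wE] := fZ x; exists w.
Qed.

(** Regularity depends only on the set of shifts occurring in each homological degree; this
    inclusion, used in both directions, shows that the set is the same for all minimal
    resolutions. *)
Lemma shift_unique (F F' : graded_res k U) i (r : 'I_(rk F i)) :
  exists c : 'I_(rk F' i), sh c = sh r.
Proof.
pose ok i (f : {linear res_mod F i -> res_mod F' i}) :=
  homog_mx (@sh _ _ _ F i) (@sh _ _ _ F' i) (lin1_mx f).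
have sh0 j : (fun s : 'I_(rk F j) => sh s + 0) = @sh _ _ _ F j.
  by apply/funext => s; rewrite addr0.
have [A0 A0h A0E] := graded_lift0 F' F U_up (@homog1 n k).
have [B0 _ B0E] := graded_lift0 F F' U_up (@homog1 n k).
have A0Z (v : res_mod F 0) : res_cycle v -> res_cycle (F := F') (mulmxr A0 v).
  move=> vZ; rewrite /res_cycle /=.
  rewrite -[X in mono_ideal _ X](subrK (1 * (v *m aug F) 0 0)).
  by apply: mono_idealD => //; rewrite mul1r.
have B0Z (v : res_mod F' 0) : res_cycle v -> res_cycle (F := F) (mulmxr B0 v).
  move=> vZ; rewrite /res_cycle /=.
  rewrite -[X in mono_ideal _ X](subrK (1 * (v *m aug F') 0 0)).
  by apply: mono_idealD => //; rewrite mul1r.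
have [] := @comparison S (res_mod F) (res_mod F') (res_diff F) (res_diff F')
  (fun i v => @res_cycle _ _ _ F i v) (fun i v => @res_cycle _ _ _ F' i v) ok
  (fun i v => in_max_ideal v) (@res_cycle_diff F) _ _ _ _ _ _ _ _
  (mulmxr A0) (mulmxr B0) _ A0Z B0Z _ i => //.
- move=> j f okf fZ.
  have AZ (v : 'rV_(rk F j)) :
      res_cycle v -> res_cycle (F := F') (v *m lin1_mx f).
    by rewrite mul_rV_lin1; apply: fZ.
  have := @graded_lift _ _ _ _ F' F 0 j (lin1_mx f); rewrite !sh0.
  move=> /(_ okf AZ)[B Bh BE]; exists (mulmxr B) => [|x].
    move=> r' c'; have := Bh r' c'; congr homog_of_deg.
    by rewrite mxE /= -rowE mxE.
  by rewrite /res_diff /= -mulmxA BE mulmxA mul_rV_lin1.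
- move=> j g gZ; apply: (res_lift (f := g \o res_diff F' j)).
    exact: row_projective.
  by move=> x; apply: gZ; apply: res_cycle_diff.
- by move=> j e eZ; apply: res_lift => //; apply: row_projective.
- by move=> j x y; apply: in_max_idealD.
- exact: res_diff_min.
- by move=> j h x; apply: in_max_ideal_lin.
- move=> r' c'; have := A0h r' c'; rewrite addr0; congr homog_of_deg.
  by rewrite mxE /= -rowE mxE.
- move=> v /=; rewrite /res_cycle /=.
  have -> : ((v *m A0 *m B0 - v) *m aug F) 0 0 =
    ((v *m A0 *m B0 *m aug F) 0 0 - 1 * (v *m A0 *m aug F') 0 0) +
    ((v *m A0 *m aug F') 0 0 - 1 * (v *m aug F) 0 0).
    by rewrite mulmxBl mxE [X in _ + X]mxE; ring.
  by apply: mono_idealD.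
(* A constant entry of f from r to c forces the shifts of r and c to agree. *)
move=> f okf [g gf]; apply: contrapT => no_c.
have := gf (delta_mx 0 r) r.
rewrite -(mul_rV_lin1 f) -(mul_rV_lin1 g) -rowE.
rewrite mxE [X in _ + X]mxE !mxE !eqxx /=.
rewrite mcoeffB mcoeff1 eqxx raddf_sum big1 /=.
  by rewrite sub0r => /eqP; rewrite oppr_eq0 oner_eq0.
move=> c _; rewrite rmorphM /= mxE.
have -> : (lin1_mx f r c)@_0%MM = 0; last by rewrite mul0r.
apply/eqP; apply: contraT => /(proj1 (homog_coeffP _ _) (okf r c)).
by rewrite mdeg0 => h; case: no_c; exists c; lia.
Qed.

(** If [P] vanished in degree [l], the identity of the nonzero free module [res_mod F l] would
    factor through 0 modulo the maximal ideal. No grading enters, so the condition carried by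
    [comparison] is taken trivial. *)
Lemma proj_resolution_length (M : lmodType S) (F : graded_res k U)
    (eps : {linear res_mod F 0 -> M}) (P : proj_resolution M) l l' :
    surj_fun eps -> (forall v, eps v = 0 <-> res_cycle v) ->
    pres_length_le P l' -> rk F l <> 0%N -> (l <= l')%N.
Proof.
move=> eps_surj epsZ P_l' F_l; rewrite leqNgt; apply/negP => lt_l.
have [f0 f0E] := row_projective eps (pres_aug_surj P).
have [g0 g0E] := @pres_proj _ _ P 0%N _ _ eps (pres_aug P) eps_surj.
pose ZQ i : pres_mod P i -> Prop :=
  match i with
  | 0 => fun x => pres_aug P x = 0
  | j.+1 => fun x => pres_diff P j x = 0
  end.
have ZQ_exact i (x : pres_mod P i) : ZQ i x <-> exists y, pres_diff P i y = x.
  case: i x => [|i] x; [exact: pres_exact0 | exact: pres_exact].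
have [] := @comparison S (res_mod F) (pres_mod P) (res_diff F) (pres_diff P)
  (fun i v => @res_cycle _ _ _ F i v) ZQ (fun _ _ => True)
  (fun i v => in_max_ideal v) (@res_cycle_diff F) _ _ _ _ _ _ _ _
  f0 g0 _ _ _ _ l => //.
- move=> j f _ fZ; have [|h hE] := projective_lift (q := pres_diff P j)
    (f := f \o res_diff F j) (@row_projective _ _); last by exists h.
  by move=> x; apply/ZQ_exact; apply: fZ; apply: res_cycle_diff.
- move=> j g gZ; apply: (res_lift (f := g \o pres_diff P j)).
    exact: pres_proj.
  by move=> x; apply: gZ; apply/ZQ_exact; exists x.
- by move=> j e eZ; apply: res_lift => //; apply: row_projective.
- by move=> j x y; apply: in_max_idealD.
- exact: res_diff_min.
- by move=> j h x; apply: in_max_ideal_lin.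
- by move=> v /epsZ v0; rewrite /ZQ f0E.
- by move=> v v0; apply/epsZ; rewrite g0E.
- by move=> v; apply/epsZ; rewrite linearB /= g0E f0E subrr.
move=> f _ [g gf]; have F_l0 : (0 < rk F l)%N by rewrite lt0n; apply/eqP.
pose r := Ordinal F_l0; have := gf (delta_mx 0 r) r.
rewrite (P_l' l lt_l (f _)) linear0 sub0r !mxE !eqxx /= mcoeffN mcoeff1 eqxx.
by move=> /eqP; rewrite oppr_eq0 oner_eq0.
Qed.

End Invariance.

(** * Passing between matrix resolutions and resolutions of the quotient module *)

Section CyclicModules.
Variables (n : nat) (k : fieldType) (t : nat).
Local Notation S := {mpoly k[n]}.
Variables (g : 'I_t -> S) (U : 'X_{1..n} -> Prop).
Hypothesis gU : forall f, f \in ideal_gen g <-> mono_ideal U f.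
Hypothesis U_up : upward U.

Lemma cyclic_pi_eq0 f : cyclic_pi g f = 0 <-> mono_ideal U f.
Proof.
by rewrite -gU -[X in _ = X](linear0 (cyclic_pi g)) cyclic_pi_eq subr0.
Qed.

Section FromGradedRes.
Variable F : graded_res k U.

Definition cyclic_aug (v : 'rV[S]_(rk F 0)) : cyclic_mod g :=
  cyclic_pi g ((v *m aug F) 0 0).

Fact cyclic_aug_linear : linear cyclic_aug.
Proof.
move=> a u v; rewrite /cyclic_aug mulmxDl -scalemxAl.
by rewrite mxE [X in X + _]mxE linearP.
Qed.

HB.instance Definition _ :=
  GRing.isLinear.Build S _ _ _ cyclic_aug cyclic_aug_linear.

Lemma cyclic_aug_surj : surj_fun cyclic_aug.
Proof.
move=> x; have [f <-] := cyclic_pi_surj x; have [v vE] := aug_surj F.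
exists (f *: v); apply/cyclic_pi_eq/gU.
rewrite -scalemxAl mxE -{2}[f]mulr1 -mulrBr.
exact: mono_idealM.
Qed.

Lemma cyclic_aug_eq0 v : cyclic_aug v = 0 <-> res_cycle v.
Proof. exact: cyclic_pi_eq0. Qed.

Lemma cyclic_aug_exact : exact_at (rv_mul (df F 0)) cyclic_aug.
Proof. by move=> v; rewrite cyclic_aug_eq0; apply: df_exact. Qed.

Lemma rv_mul_exact i : exact_at (rv_mul (df F i.+1)) (rv_mul (df F i)).
Proof. by move=> v; apply: (@df_exact _ _ _ F i.+1 v). Qed.

Lemma cyclic_aug_deg r : cyclic_deg (sh r) (cyclic_aug (delta_mx 0 r)).
Proof.
exists (aug F r 0); first exact: aug_homog.
by rewrite /cyclic_aug -rowE mxE.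
Qed.

Definition min_res_of : min_graded_free_resolution (@cyclic_deg n k t g) :=
  @MinGradedFreeResolution n k _ (@cyclic_deg n k t g)
    (rk F) (@sh _ _ _ F) (df F) cyclic_aug cyclic_aug_surj cyclic_aug_exact
    rv_mul_exact cyclic_aug_deg (@df_homog _ _ _ F) (@df_min _ _ _ F).

Definition proj_res_of : proj_resolution (cyclic_mod g) :=
  @ProjResolution S (cyclic_mod g) (res_mod F) (res_diff F) cyclic_aug
    (fun i => @row_projective _ _) cyclic_aug_surj cyclic_aug_exact
    rv_mul_exact.

End FromGradedRes.

(** Homogeneous representatives of the images of the basis vectors form the augmentation column,
    which puts an arbitrary minimal resolution into the form required by [shift_unique]. *)
Lemma graded_res_of (R : min_graded_free_resolution (@cyclic_deg n k t g)) :
  exists F : graded_res k U, forall i j,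
    (exists r : 'I_(rk F i), sh r = j) <-> betti R i j <> 0%N.
Proof.
have /choice[a aE] (r : 'I_(gres_rank R 0)) : exists f,
    homog_of_deg (gres_shift r) f /\ gres_aug R (delta_mx 0 r) = cyclic_pi g f.
  by have [f fh fE] := gres_aug_homog r; exists f.
pose A : 'cV[S]_(gres_rank R 0) := \col_r a r.
have augE v : gres_aug R v = cyclic_pi g ((v *m A) 0 0).
  rewrite [in LHS](row_sum_delta v) linear_sum mxE linear_sum /=.
  apply: eq_bigr => r _; rewrite linearZ /= (aE r).2 mxE.
  by rewrite -[v 0 r * a r]/(v 0 r *: (a r : S^o)) linearZ.
have surjR : exists v : 'rV_(gres_rank R 0), mono_ideal U ((v *m A) 0 0 - 1).
  have [v vE] := gres_aug_surj R (cyclic_pi g 1).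
  by exists v; apply/gU/cyclic_pi_eq; rewrite -augE.
have exactR i (v : 'rV_(gres_rank R i)) :
    @is_cycle n k U (gres_rank R) A (gres_diff R) i v <->
    exists w, w *m gres_diff R i = v.
  case: i v => [|i] v; last exact: gres_exact.
  by rewrite /= -cyclic_pi_eq0 -augE; apply: gres_exact0.
have Ah r : homog_of_deg (gres_shift r) (A r 0) by rewrite mxE; case: (aE r).
exists (@GradedRes n k U _ (@gres_shift _ _ _ _ R) A _ surjR exactR Ah
  (@gres_diff_homog _ _ _ _ R) (@gres_minimal _ _ _ _ R)) => i j /=.
rewrite /betti; split=> [[r rE]|/eqP].
  by apply/eqP; rewrite cards_eq0; apply/set0Pn; exists r; rewrite inE rE.
rewrite cards_eq0 => /set0Pn[r]; rewrite inE => /eqP rE.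
by exists r.
Qed.

Lemma cyclic_regularity rho l :
  resolved k U rho l -> has_regularity (@cyclic_deg n k t g) rho%:Z.
Proof.
move=> [_ [F [F_le [i0 [r0 r0E]] _ _]]]; split=> [|R].
  by constructor; apply: min_res_of.
have [F' F'E] := graded_res_of R; split.
  have [c cE] := shift_unique U_up F' r0.
  exists i0, (sh r0); split; first by apply/F'E; exists c.
  by rewrite r0E; lia.
move=> y [i [j [/F'E[r rE] ->]]].
have [c cE] := shift_unique U_up F r.
by have := F_le i c; rewrite cE rE; lia.
Qed.

Lemma cyclic_projdim rho l :
  resolved k U rho l -> has_projdim (cyclic_mod g : lmodType S) l.
Proof.
move=> [_ [F [_ _ F_l F_l0]]]; split=> [|P l' P_l'].
  exists (proj_res_of F) => i lt_i x; apply/rowP => c.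
  by have := ltn_ord c; rewrite [X in (_ < X)%N -> _](F_l i lt_i).
exact: (proj_resolution_length (cyclic_aug_surj F) (@cyclic_aug_eq0 F)
  P_l' F_l0).
Qed.

End CyclicModules.

(** * The closed neighborhood ideal as a monomial ideal, and the final formulas *)

Lemma ideal_gen_monomials (n t : nat) (k : fieldType) (a : 'I_t -> 'X_{1..n})
    (f : {mpoly k[n]}) :
  f \in ideal_gen (fun i => 'X_[k, a i]) <->
  mono_ideal (fun m => exists i, (a i <= m)%MM) f.
Proof.
split=> [/ideal_genP[c ->]|hf].
  apply: mono_ideal_sum => i m; rewrite (perm_mem (msuppMX _ _)).
  by move=> /mapP[m' _ ->]; exists i; apply: lem_addr.
rewrite (mpolyE f) big_seq; apply: rpred_sum => m /hf[i am].
rewrite -mul_mpolyC -(submK am) mpolyXD mulrA; apply: ideal_genM.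
apply/ideal_genP; exists (fun j => (j == i)%:R).
rewrite (bigD1 i) //= eqxx mul1r big1 ?addr0 // => j ne.
by rewrite (negPf ne) mul0r.
Qed.

Lemma NI_genE (n : nat) (k : fieldType) (e : rel 'I_n) (i : 'I_n) :
  NI_gen k e i = 'X_[k, [multinom (j \in closed_nbhd e i : nat) | j < n]].
Proof.
rewrite mpolyXE_id /NI_gen big_mkcond /=; apply: eq_bigr => j _.
by rewrite mnmE; case: ifP.
Qed.

(** The generator at [i] divides a monomial exactly when the support contains all indices at
    distance at most 2 from [i], which is how [covers_nbhd] describes it. *)
Lemma NI_path_sq (n : nat) (k : fieldType) (f : {mpoly k[n]}) :
  f \in ideal_gen (NI_gen k (@path_sq n)) <->
  mono_ideal (fun m => covers_nbhd n (msup m)) f.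
Proof.
have -> : NI_gen k (@path_sq n) = fun i =>
    'X_[k, [multinom (j \in closed_nbhd (@path_sq n) i : nat) | j < n]].
  by apply/funext => i; apply: NI_genE.
apply: (iff_trans (ideal_gen_monomials _ _)).
suff -> : (fun m : 'X_{1..n} => exists i : 'I_n,
    ([multinom (j \in closed_nbhd (@path_sq n) i : nat) | j < n] <= m)%MM) =
  (fun m => covers_nbhd n (msup m)) by [].
apply/funext => m; apply/propext; split=> [[i /mnm_lepP le_m]|[c [lt_c Pc]]].
  exists i; split=> // j lt_j ij ji; have := le_m (Ordinal lt_j).
  have := msup_ord m (Ordinal lt_j); rewrite /= => ->.
  rewrite mnmE inE -val_eqE /path_sq /=.
  have -> : [|| j == i :> nat, j == i.+1, i == j.+1 :> nat, j == i.+2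
    | i == j.+2 :> nat] by lia.
  by rewrite lt0n.
exists (Ordinal lt_c); apply/mnm_lepP => j.
rewrite mnmE inE -val_eqE /path_sq /=.
by have := Pc j (ltn_ord j); rewrite msup_ord; lia.
Qed.

Theorem theorem1p11 (k : fieldType) (n p d : nat)
    (n_ge1 : (1 <= n)%N) (d_le5 : (d <= 5)%N) (n_eq : n = (6 * p + d)%N) :
  has_regularity (@NI_deg n k (@path_sq n))
    (Posz (if (d <= 1)%N then 4 * p
           else if d == 2 then 4 * p + 1
           else if (d <= 4)%N then 4 * p + 2
           else 4 * p + 3)%N) /\
  has_projdim (NI_quot k (@path_sq n))
    (if d == 0 then 2 * p
     else if (d <= 3)%N then 2 * p + 1
     else 2 * p + 2)%N.
Proof.
(* The values are floor(2n/3) and ceil(n/3); both case lists follow by substituting n = 6p + d for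
   each d. *)
have resN := @resolved_covers_nbhd n k n (leqnn n); have U_up := proj1 resN.
have gU := @NI_path_sq n k.
split.
  have := cyclic_regularity gU U_up resN; congr has_regularity; congr Posz.
  by move: d_le5 n_eq; case: d => [|[|[|[|[|[|]]]]]] //= _ ->; lia.
have := cyclic_projdim gU U_up resN; congr has_projdim.
by move: d_le5 n_eq; case: d => [|[|[|[|[|[|]]]]]] //= _ ->; lia.
Qed.
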